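(* Let $(M,g)$ be a general relativistic perfect fluid spacetime with isotropic pressure $p$, energy-density $\sigma$, cosmological constant $\lambda$, gravitational constant $k$ and velocity vector field $\xi$, and suppose that $(g,\xi,a)$ is a Ricci soliton in $M$, i.e. $\mathcal{L}_{\xi}g+2S+2ag=0$ with $a$ a real constant. Then $$a=-\lambda+\frac{k(\sigma+3p)}{2},$$ and the soliton is steady if $p=\frac{2}{3}\left(\frac{\lambda}{k}\right)-\frac{\sigma}{3}$, expanding if $p>\frac{2}{3}\left(\frac{\lambda}{k}\right)-\frac{\sigma}{3}$ and shrinking if $p<\frac{2}{3}\left(\frac{\lambda}{k}\right)-\frac{\sigma}{3}$. In these cases $\mathrm{div}(\xi)=-3k(\sigma+p)$. Moreover, if the Plebanski energy conditions $\sigma\geq 0$ and $-\sigma\leq p\leq\sigma$ hold, then $\sigma\geq\max\{-\frac{\lambda}{k},\frac{\lambda}{2k}\}$ in the steady case, $\sigma>\frac{\lambda}{2k}$ in the expanding case, and $\sigma>-\frac{\lambda}{k}$ in the shrinking case.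
   Context: A perfect fluid spacetime here is a $4$-dimensional smooth manifold $M$ with a Lorentzian metric $g$ (one negative sign in the signature), a smooth velocity vector field $\xi$ with $g(\xi,\xi)=-1$ and dual $1$-form $\eta(X)=g(X,\xi)$, and smooth functions $p$ (pressure) and $\sigma$ (energy-density), such that Einstein's equations $kT=S+(\lambda-\frac r2)g$ hold with $T=pg+(\sigma+p)\eta\otimes\eta$; equivalently $$S(X,Y)=\left(\lambda+\frac{k(\sigma-p)}{2}\right)g(X,Y)+k(\sigma+p)\eta(X)\eta(Y)$$ for all vector fields $X,Y$. Here $S$ is the Ricci tensor, $r$ the scalar curvature, $\lambda$ a real constant and $k>0$ a real constant (e.g. $k=8\pi G$). $\mathcal{L}_\xi g$ is the Lie derivative, $\mathrm{div}(\xi)$ the trace of $X\mapsto\nabla_X\xi$. A Ricci soliton $(g,\xi,a)$ is called shrinking, steady or expanding according as $a$ is negative, zero or positive. *)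

(* Defs.v *)
(* MathComp-Analysis, over an arbitrary realType R standing for the reals.

   Tensor fields on a manifold are given classically: by their components in
   every chart, subject to the transformation law on chart overlaps.  The
   component functions are total on 'rV[R]_n, but only their values on the
   open set chart_img i are ever constrained or used.  Vectors are rows, and
   the bilinear form with Gram matrix A is (u, v) |-> u *m A *m v^T. *)
From HB Require Import structures.
From mathcomp Require Import all_boot all_order all_algebra.
From mathcomp Require Import all_classical all_reals all_analysis.

Set Implicit Arguments.
Unset Strict Implicit.
Unset Printing Implicit Defensive.

Import Order.TTheory GRing.Theory Num.Theory.
Import numFieldNormedType.Exports.

Local Open Scope classical_set_scope.
Local Open Scope ring_scope.

Section Smooth.
Context {R : realType} {n : nat} {V : normedModType R}.

Definition partial (i : 'I_n) (f : 'rV[R]_n -> V) : 'rV[R]_n -> V :=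
  fun x => 'D_(delta_mx 0 i) f x.

(* C^oo on an open set O: f and all its iterated partial derivatives are
   (Frechet) differentiable at every point of O. *)
Definition smooth_on (O : set 'rV[R]_n) (f : 'rV[R]_n -> V) : Prop :=
  forall s : seq 'I_n, {in O, forall x, differentiable (foldr partial f s) x}.

End Smooth.

(* n-dimensional smooth manifolds, presented by an atlas: chart_param i is
   inverse to the chart chart_coord i on the domain chart_dom i, and arbitrary
   outside the image chart_img i. *)
Record manifold (R : realType) (n : nat) := Manifold {
  carrier :> topologicalType;
  chart : Type;
  chart_dom : chart -> set carrier;
  chart_coord : chart -> carrier -> 'rV[R]_n;
  chart_param : chart -> 'rV[R]_n -> carrier;
  chart_img := fun i => chart_coord i @` chart_dom i;
  manifold_hausdorff : hausdorff_space carrier;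
  manifold_second_countable : @second_countable carrier;
  chart_cover : forall q, exists i, chart_dom i q;
  chart_dom_open : forall i, open (chart_dom i);
  chart_img_open : forall i, open (chart_img i);
  chart_coordK : forall i,
    {in chart_dom i, cancel (chart_coord i) (chart_param i)};
  chart_coord_continuous : forall i,
    {within chart_dom i, continuous (chart_coord i)};
  chart_param_continuous : forall i,
    {within chart_img i, continuous (chart_param i)};
  transition_smooth : forall i j,
    smooth_on (chart_coord i @` (chart_dom i `&` chart_dom j))
              (chart_coord j \o chart_param i)
}.

Definition smooth_function (R : realType) (n : nat) (M : manifold R n)
    (f : M -> R) : Prop :=
  forall i : chart M, smooth_on (chart_img i) (f \o chart_param i).

Record vector_field (R : realType) (n : nat) (M : manifold R n) := VectorField {
  vf_comp :> chart M -> 'rV[R]_n -> 'rV[R]_n;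
  vf_smooth : forall i, smooth_on (chart_img i) (vf_comp i);
  vf_transform : forall i j q, chart_dom i q -> chart_dom j q ->
    let J := 'J (chart_coord j \o chart_param i) (chart_coord i q) in
    vf_comp j (chart_coord j q) = vf_comp i (chart_coord i q) *m J
}.

(* Lorentzian metrics, with signature (-, +, ..., +). *)
Record lorentz_metric (R : realType) (n : nat) (M : manifold R n) :=
  LorentzMetric {
  metric_comp :> chart M -> 'rV[R]_n -> 'M[R]_n;
  metric_smooth : forall i, smooth_on (chart_img i) (metric_comp i);
  metric_transform : forall i j q, chart_dom i q -> chart_dom j q ->
    let J := 'J (chart_coord j \o chart_param i) (chart_coord i q) in
    metric_comp i (chart_coord i q) =
      J *m metric_comp j (chart_coord j q) *m J^T;
  metric_sym : forall i, {in chart_img i, forall x,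
    (metric_comp i x)^T = metric_comp i x};
  metric_lorentz : forall i, {in chart_img i, forall x,
    exists2 P : 'M[R]_n, P \in unitmx &
      P *m metric_comp i x *m P^T =
        diag_mx (\row_(l < n) (if l == 0%N :> nat then -1 else 1))}
}.

(* Pseudo-Riemannian geometry in one chart: G is the Gram matrix of the metric,
   and X, Y, Z are vector fields on the chart. *)
Section LocalGeometry.
Context {R : realType} {n : nat}.
Variable G : 'rV[R]_n -> 'M[R]_n.
Implicit Types (X Y Z : 'rV[R]_n -> 'rV[R]_n) (x : 'rV[R]_n).

(* The coordinate vector field d/dx_i. *)
Definition frame (i : 'I_n) : 'rV[R]_n -> 'rV[R]_n := fun _ => delta_mx 0 i.

Definition inner X Y x : R := (X x *m G x *m (Y x)^T) 0 0.

Definition lie_bracket X Y x : 'rV[R]_n := 'D_(X x) Y x - 'D_(Y x) X x.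

(* Christoffel symbols of the second kind: the l-th entry of christoffel i j x
   is the symbol with lower indices i, j and upper index l. *)
Definition christoffel (i j : 'I_n) x : 'rV[R]_n :=
  2^-1 *: (\row_l (partial i (fun y => G y j l) x +
                   partial j (fun y => G y i l) x -
                   partial l (fun y => G y i j) x)) *m invmx (G x).

(* Levi-Civita connection: nabla X Y is the covariant derivative of Y along
   X. *)
Definition nabla X Y x : 'rV[R]_n :=
  'D_(X x) Y x + \sum_i \sum_j (X x 0 i * Y x 0 j) *: christoffel i j x.

Definition riemann X Y Z x : 'rV[R]_n :=
  nabla X (nabla Y Z) x - nabla Y (nabla X Z) x - nabla (lie_bracket X Y) Z x.

(* S(Y, Z) is the trace of X |-> R(X, Y)Z; ricci is its matrix. *)
Definition ricci_form Y Z x : R := \sum_i riemann (frame i) Y Z x 0 i.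

Definition ricci x : 'M[R]_n := \matrix_(i, j) ricci_form (frame i) (frame j) x.

Definition scalar_curvature x : R := \tr (invmx (G x) *m ricci x).

Definition lie_metric_form (xi X Y : 'rV[R]_n -> 'rV[R]_n) x : R :=
  'D_(xi x) (inner X Y) x -
  inner (lie_bracket xi X) Y x - inner X (lie_bracket xi Y) x.

Definition lie_metric (xi : 'rV[R]_n -> 'rV[R]_n) x : 'M[R]_n :=
  \matrix_(i, j) lie_metric_form xi (frame i) (frame j) x.

(* Trace of X |-> nabla X xi. *)
Definition divergence (xi : 'rV[R]_n -> 'rV[R]_n) x : R :=
  \sum_i nabla (frame i) xi x 0 i.

(* Components of the 1-form X |-> g(X, xi). *)
Definition dual_form (xi : 'rV[R]_n -> 'rV[R]_n) x : 'rV[R]_n :=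
  \row_i inner (frame i) xi x.

End LocalGeometry.

Section Spacetime.
Context {R : realType} {n : nat} {M : manifold R n}.
Variables (g : lorentz_metric M) (xi : vector_field M).

(* The energy-momentum tensor p g + (sigma + p) eta (x) eta at q, in the
   chart i. *)
Definition energy_momentum (p sigma : M -> R) (i : chart M) (q : M) : 'M[R]_n :=
  let x := chart_coord i q in
  let eta := dual_form (g i) (xi i) x in
  p q *: g i x + (sigma q + p q) *: (eta^T *m eta).

Definition perfect_fluid (p sigma : M -> R) (lambda k : R) : Prop :=
  [/\ smooth_function p, smooth_function sigma,
      (forall (i : chart M) q, chart_dom i q ->
         inner (g i) (xi i) (xi i) (chart_coord i q) = -1) &
      forall (i : chart M) q, chart_dom i q ->
        let x := chart_coord i q in
        k *: energy_momentum p sigma i q =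
          ricci (g i) x + (lambda - scalar_curvature (g i) x / 2) *: g i x].

Definition ricci_soliton (a : R) : Prop :=
  forall (i : chart M) q, chart_dom i q ->
    let x := chart_coord i q in
    lie_metric (g i) (xi i) x + 2 *: ricci (g i) x + (2 * a) *: g i x = 0.

End Spacetime.

(* The type of a Ricci soliton (g, xi, a). *)
Definition steady (R : realType) (a : R) : Prop := a = 0.
Definition expanding (R : realType) (a : R) : Prop := 0 < a.
Definition shrinking (R : realType) (a : R) : Prop := a < 0.

(* Main.v *)
(* Everything is pointwise in a chart.  Tracing Einstein's equations gives
   r = 4 lambda - k (3 p - sigma), hence S.  Since g(xi, xi) = -1 is constant,
   (L_xi g)(xi, xi) = D_xi g(xi, xi) = 0, so the soliton equation contracted
   with (xi, xi) reads S(xi, xi) = a, which is the formula for a; its trace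
   2 div(xi) + 2 r + 8 a = 0 gives the divergence. *)
Require Import Defs.
From mathcomp Require Import all_boot all_order all_algebra.
From mathcomp Require Import all_classical all_reals all_analysis.
From mathcomp Require Import ring lra.

Set Implicit Arguments.
Unset Strict Implicit.
Unset Printing Implicit Defensive.

Import Order.TTheory GRing.Theory Num.Theory.
Import numFieldNormedType.Exports.

Local Open Scope classical_set_scope.
Local Open Scope ring_scope.

(** * Calculus of matrix-valued functions *)

Lemma is_derive_mulmx (R : realFieldType) (V : normedModType R) (m n k : nat)
    (F : V -> 'M[R]_(m, n)) (H : V -> 'M[R]_(n, k)) (dF : 'M[R]_(m, n))
    (dH : 'M[R]_(n, k)) (x v : V) :
  is_derive x v F dF -> is_derive x v H dH ->
  is_derive x v (fun y => F y *m H y) (dF *m H x + F x *m dH).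
Proof.
move=> [Fx <-] [Hx <-].
have Fij i j := (derivable_mxP F x v).1 Fx i j.
have Hij i j := (derivable_mxP H x v).1 Hx i j.
have FH i j : is_derive x v (fun y => (F y *m H y) i j)
    (('D_v F x *m H x + F x *m 'D_v H x) i j).
  (* Each entry is recast as a sum of functions, so that the scalar Leibniz rule applies
     termwise. *)
  rewrite (_ : (fun y => _) = \sum_l (fun y => F y i l * H y l j)); last first.
    by apply/funext => y; rewrite mxE fct_sumE.
  have hl l : is_derive x v (fun y => F y i l * H y l j)
      (F x i l * 'D_v (fun y => H y l j) x + H x l j * 'D_v (fun y => F y i l) x).
    by apply: is_deriveM; apply/derivableP.
  apply: is_derive_eq.
  rewrite !mxE -big_split; apply: eq_bigr => l _ /=.
  by rewrite !derive_mx // !mxE addrC (mulrC (H x l j)).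
have FHd : derivable (fun y => F y *m H y) x v by apply/derivable_mxP => i j.
apply: DeriveDef => //; apply/matrixP => i j.
by rewrite derive_mx // [LHS]mxE derive_val.
Qed.

Lemma derive_row (R : realFieldType) (n : nat) (V : normedModType R)
    (f : 'rV[R]_n -> V) (x v : 'rV[R]_n) :
  differentiable f x -> 'D_v f x = \sum_i v 0 i *: 'D_(delta_mx 0 i) f x.
Proof.
move=> fx; rewrite deriveE// [in LHS](row_sum_delta v) linear_sum.
by apply: eq_bigr => i _; rewrite linearZ deriveE.
Qed.

Lemma mxtrace_mul (R : comNzRingType) (m n : nat) (A : 'M[R]_(m, n))
    (B : 'M[R]_(n, m)) : \tr (A *m B) = \sum_i \sum_j A i j * B j i.
Proof. by apply: eq_bigr => i _; rewrite mxE. Qed.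

(** * Lie derivative of the metric and divergence in one chart *)

Section LocalGeometry.
Context {R : realType} {n : nat}.
Variables (G : 'rV[R]_n -> 'M[R]_n).
Variables (xi : 'rV[R]_n -> 'rV[R]_n) (x : 'rV[R]_n).
Hypothesis (dG : differentiable G x) (dxi : differentiable xi x).

(** Jacobian in the row convention: directions multiply it from the left. *)
Let J : 'M[R]_n := \matrix_i partial i xi x.

Lemma derive_jac v : 'D_v xi x = v *m J.
Proof.
rewrite derive_row//; apply/rowP => j; rewrite mxE summxE.
by apply: eq_bigr => i _; rewrite !mxE.
Qed.

(** Coordinate fields are constant, so their brackets with [xi] are minus the rows of [J]. *)
Lemma lie_metricE :
  lie_metric G xi x = 'D_(xi x) G x + J *m G x + G x *m J^T.
Proof.
apply/matrixP => i j; rewrite !mxE /lie_metric_form.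
have -> : inner G (frame i) (frame j) = fun y => G y i j.
  apply/funext => y; rewrite /inner /frame -rowE trmx_delta -colE.
  by rewrite !mxE.
have lieE k : lie_bracket xi (frame k) x = - row k J.
  rewrite /lie_bracket derive_cst sub0r; congr (- _).
  by apply/rowP => l; rewrite !mxE.
rewrite /inner !lieE !mulNmx /frame trmx_delta -colE raddfN /= !mulmxN.
rewrite -!rowE derive_mx; last exact: diff_derivable.
rewrite !mxE !opprK; congr (_ + _ + _).
  by apply: eq_bigr => l _; rewrite !mxE.
by apply: eq_bigr => l _; rewrite !mxE.
Qed.

(** Since [xi] has derivative [xi x *m J] along itself, the Leibniz rule for [xi *m G *m xi^T]
    yields exactly the three terms of [lie_metricE]. *)
Lemma lie_metric_contract :
  (xi x *m lie_metric G xi x *m (xi x)^T) 0 0 = 'D_(xi x) (inner G xi xi) x.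
Proof.
have hx : is_derive x (xi x) xi (xi x *m J).
  by rewrite -derive_jac; apply/derivableP/diff_derivable.
have hxT : is_derive x (xi x) (fun y => (xi y)^T) (xi x *m J)^T.
  have dT : derivable (fun y => (xi y)^T) x (xi x).
    apply/derivable_mxP => i j; under eq_fun do rewrite mxE.
    by apply: (derivable_mxP xi x (xi x)).1; exact: diff_derivable.
  apply: DeriveDef => //; apply/matrixP => i j.
  rewrite derive_mx// [LHS]mxE; under eq_fun do rewrite mxE.
  by rewrite mxE -[in RHS]derive_jac derive_mx ?mxE//; exact: diff_derivable.
have hG : is_derive x (xi x) G ('D_(xi x) G x).
  exact/derivableP/diff_derivable.
have [hd hv] := is_derive_mulmx (is_derive_mulmx hx hG) hxT.
have := congr1 (fun A : 'M[R]_1 => A 0 0) hv; rewrite derive_mx// mxE => ->.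
by rewrite lie_metricE trmx_mul !mulmxDr !mulmxDl !mulmxA !mxE; ring.
Qed.

(** Symmetry holds near [x], not only at [x], because it gets differentiated. *)
Hypotheses (Gsym : \forall y \near x, ((G y)^T)%R = G y) (Gunit : G x \in unitmx).

(** The classical identity for the derivative of log sqrt |det G|: contracting the upper index with
    a lower one leaves only the middle of the three terms. *)
Lemma christoffel_trace j :
  \sum_i christoffel G i j x 0 i =
  2^-1 * \tr (invmx (G x) *m 'D_(delta_mx 0 j) G x).
Proof.
set W := invmx (G x); pose D l i k := partial l (fun y => G y i k) x.
have DC l i k : D l i k = D l k i.
  by apply: near_eq_derive; apply: filterS Gsym => y /matrixP/(_ k i); rewrite mxE.
have WC i k : W i k = W k i.
  by rewrite /W -[in LHS](nbhs_singleton Gsym) -trmx_inv mxE.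
rewrite mxtrace_mul mulr_sumr derive_mx; last exact: diff_derivable.
have -> : \sum_i christoffel G i j x 0 i =
    \sum_i \sum_l 2^-1 * (W i l * D j l i)
    + 2^-1 * (\sum_i \sum_l D i j l * W l i - \sum_i \sum_l D l i j * W l i).
  rewrite -sumrB mulr_sumr -big_split; apply: eq_bigr => i _ /=.
  rewrite -sumrB mulr_sumr -big_split mxE; apply: eq_bigr => l _ /=.
  rewrite !mxE -/W -/(D i j l) -/(D j i l) -/(D l i j) (WC i l) (DC j l i); ring.
(* Exchanging the summation indices identifies the two remaining sums, by symmetry of [W] and of [D]
   in its last two indices. *)
rewrite [X in _ - X]exchange_big /=.
rewrite [X in _ - X](_ : _ = \sum_i \sum_l D i j l * W l i); last first.
  by apply: eq_bigr => i _; apply: eq_bigr => l _; rewrite DC WC.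
rewrite subrr mulr0 addr0; apply: eq_bigr => i _; rewrite mulr_sumr.
by apply: eq_bigr => l _; rewrite mxE.
Qed.

Lemma divergenceE :
  divergence G xi x = \tr J + 2^-1 * \tr (invmx (G x) *m 'D_(xi x) G x).
Proof.
rewrite /divergence /nabla; under eq_bigr do rewrite mxE.
rewrite big_split /=; congr (_ + _).
  by apply: eq_bigr => i _; rewrite !mxE.
rewrite derive_row// mulmx_sumr raddf_sum mulr_sumr /=.
under [RHS]eq_bigr => j _.
  rewrite -scalemxAr mxtraceZ mulrCA -christoffel_trace mulr_sumr; over.
rewrite [RHS]exchange_big; apply: eq_bigr => i _.
(* Only the [i]-th component of [frame i] is nonzero. *)
rewrite summxE (bigD1 i)//= [X in _ + X]big1 ?addr0 => [|l li]; last first.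
  rewrite summxE big1// => j _.
  by rewrite /frame !mxE eqxx (negPf li) !mul0r.
rewrite summxE; apply: eq_bigr => j _.
by rewrite /frame [LHS]mxE mxE !eqxx mul1r.
Qed.

(** By cyclicity, [J *m G] and [G *m J^T] each contribute [\tr J]; [divergenceE] accounts for the
    rest. *)
Lemma lie_metric_trace :
  \tr (invmx (G x) *m lie_metric G xi x) = 2 * divergence G xi x.
Proof.
rewrite lie_metricE divergenceE !mulmxDr !mxtraceD mulKmx// mxtrace_tr.
rewrite (mxtrace_mulC _ (_ *m G x)) mulmxK//; lra.
Qed.
End LocalGeometry.

(** * Einstein and soliton equations at a point of the fluid *)

Section Soliton.
Context {R : realType} {M : manifold R 4} {g : lorentz_metric M}.
Context {xi : vector_field M} {p sigma : M -> R} {lambda k a : R}.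
Hypotheses (fluid : perfect_fluid g xi p sigma lambda k).
Hypothesis (soliton : ricci_soliton g xi a).
Variables (i : chart M) (q : M).
Hypothesis (iq : chart_dom i q).

Let x := chart_coord i q.

Let xO : chart_img i x. Proof. by exists q. Qed.

Let chart_img_nbhs : nbhs x (chart_img i).
Proof. by apply: open_nbhs_nbhs; split => //; exact: chart_img_open. Qed.

Let Gsym : \forall y \near x, ((g i y)^T)%R = g i y.
Proof.
by apply: filterS chart_img_nbhs => y yO; apply: (Defs.metric_sym g); rewrite inE.
Qed.

(** Determinants in the Lorentzian normal form: a product of signs is nonzero. *)
Let Gunit : g i x \in unitmx.
Proof.
have [|P uP PGP] := @metric_lorentz _ _ _ g i x; first by rewrite inE.
have := congr1 (fun A : 'M[R]_4 => \det A) PGP.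
rewrite !det_mulmx det_tr det_diag => dP.
rewrite unitmxE unitfE; apply: contra_eq_neq dP => ->.
rewrite mulr0 mul0r eq_sym; apply/prodf_neq0 => l _; rewrite mxE.
by case: ifP => _; rewrite ?oppr_eq0 oner_eq0.
Qed.

Let dG : differentiable (g i) x.
Proof. by apply: (@metric_smooth _ _ _ g i [::]); rewrite inE. Qed.

Let dxi : differentiable (xi i) x.
Proof. by apply: (@vf_smooth _ _ _ xi i [::]); rewrite inE. Qed.

Let unit_timelike : inner (g i) (xi i) (xi i) x = -1.
Proof. by case: fluid => _ _ /(_ i q iq). Qed.

Let eta := dual_form (g i) (xi i) x.

Let etaE : eta = xi i x *m g i x.
Proof.
apply/rowP => l; rewrite mxE /inner /frame -rowE -[in RHS](nbhs_singleton Gsym).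
by rewrite !mxE; apply: eq_bigr => m _; rewrite !mxE mulrC.
Qed.

(* The left-hand side is the derivative of [g(xi, xi)], which is constant. *)
Let lie_metric_xi : (xi i x *m lie_metric (g i) (xi i) x *m (xi i x)^T) 0 0 = 0.
Proof.
rewrite lie_metric_contract//.
rewrite (@near_eq_derive _ _ _ _ (cst (-1 : R))) ?derive_cst//.
by apply: filterS chart_img_nbhs => _ [q' iq' <-]; case: fluid => _ _ /(_ i q' iq').
Qed.

Lemma einstein_trace :
  scalar_curvature (g i) x = 4 * lambda - k * (3 * p q - sigma q).
Proof.
case: fluid => _ _ _ /(_ i q iq) /(congr1 (fun A => \tr (invmx (g i x) *m A))).
rewrite /= -/x /energy_momentum -/x -/eta.
rewrite -scalemxAr !mulmxDr -!scalemxAr !(mxtraceZ, mxtraceD) mulVmx// mxtrace1.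
(* By cyclicity this is the squared norm of the covector [eta], equal to g(xi, xi). *)
have -> : \tr (invmx (g i x) *m (eta^T *m eta)) = -1.
  rewrite mxtrace_mulC -mulmxA mxtrace_mulC etaE mulmxK//.
  rewrite trmx_mul (nbhs_singleton Gsym) mulmxA /mxtrace big_ord1.
  exact: unit_timelike.
rewrite -/(scalar_curvature _ _); lra.
Qed.

(** Contracted with (xi, xi), Einstein's equations give S(xi, xi) = lambda - r/2 + k sigma, and the
    soliton equation gives S(xi, xi) = a. *)
Lemma soliton_constant : a = - lambda + k * (sigma q + 3 * p q) / 2.
Proof.
have tr := einstein_trace; have NG := unit_timelike; rewrite /inner in NG.
have Nl := lie_metric_xi.
case: fluid => _ _ _ /(_ i q iq)
  /(congr1 (fun A => (xi i x *m A *m (xi i x)^T) 0 0)).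
have := congr1 (fun A => (xi i x *m A *m (xi i x)^T) 0 0) (soliton iq).
rewrite /= /energy_momentum -/x -/eta tr mulmx0 mul0mx.
have : (xi i x *m (eta^T *m eta) *m (xi i x)^T) 0 0 = 1.
  rewrite !mulmxA -mulmxA mxE big_ord1 etaE.
  have -> : xi i x *m (xi i x *m g i x)^T = xi i x *m g i x *m (xi i x)^T.
    by rewrite trmx_mul (nbhs_singleton Gsym) mulmxA.
  by rewrite NG mulrNN mulr1.
(* [E] shields the product from the distributivity rewrites; the quadratic forms then become opaque
   1 x 1 matrices, leaving a linear problem. *)
move: (eta^T *m eta) NG Nl => E.
rewrite !(mulmxDr, mulmxDl, =^~ scalemxAr, =^~ scalemxAl).
move: (_ *m E *m _) (_ *m lie_metric _ _ _ *m _) (_ *m g i x *m _)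
  (_ *m ricci _ _ *m _) => A B C D.
rewrite !mxE => -> -> ->; lra.
Qed.

(** The trace gives div(xi) = - r - 4 a, where lambda cancels. *)
Lemma soliton_divergence :
  divergence (g i) (xi i) x = - 3 * k * (sigma q + p q).
Proof.
have tr := einstein_trace; have aE := soliton_constant.
have := congr1 (fun A => \tr (invmx (g i x) *m A)) (soliton iq).
rewrite /= -/x !mulmxDr -!scalemxAr !(mxtraceZ, mxtraceD) mulVmx// mxtrace1.
rewrite mulmx0 mxtrace0 lie_metric_trace// -/(scalar_curvature _ _); lra.
Qed.

End Soliton.

Theorem mainTheorem5 (R : realType) (M : manifold R 4)
    (g : lorentz_metric M) (xi : vector_field M) (p sigma : M -> R)
    (lambda k a : R) (k_gt0 : 0 < k)
    (fluid : perfect_fluid g xi p sigma lambda k)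
    (soliton : ricci_soliton g xi a) :
  [/\ forall q : M, a = - lambda + k * (sigma q + 3 * p q) / 2,
      forall q : M,
        [/\ p q = 2 / 3 * (lambda / k) - sigma q / 3 -> steady a,
            p q > 2 / 3 * (lambda / k) - sigma q / 3 -> expanding a &
            p q < 2 / 3 * (lambda / k) - sigma q / 3 -> shrinking a],
      forall (i : chart M) (q : M), chart_dom i q ->
        divergence (g i) (xi i) (chart_coord i q) = - 3 * k * (sigma q + p q) &
      forall q : M, 0 <= sigma q -> - sigma q <= p q <= sigma q ->
        [/\ steady a -> Num.max (- (lambda / k)) (lambda / (2 * k)) <= sigma q,
            expanding a -> lambda / (2 * k) < sigma q &
            shrinking a -> - (lambda / k) < sigma q]].
Proof.
have aE q : a = - lambda + k * (sigma q + 3 * p q) / 2.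
  by have [i iq] := chart_cover q; exact: (soliton_constant fluid soliton iq).
(* Factoring out the positive 3k/2 shows that [a] has the sign of the pressure minus its
   threshold. *)
have aE' q : a = 3 / 2 * k * (p q - (2 / 3 * (lambda / k) - sigma q / 3)).
  by rewrite (aE q); field; rewrite gt_eqF.
split => //.
- move=> q; rewrite /steady /expanding /shrinking (aE' q).
  have k32 : 0 < 3 / 2 * k by rewrite mulr_gt0.
  split => [->|pq|pq]; first by rewrite subrr mulr0.
    by rewrite pmulr_rgt0// subr_gt0.
  by rewrite pmulr_rlt0// subr_lt0.
- by move=> i q iq; exact: (soliton_divergence fluid soliton iq).
- move=> q sigma_ge0 /andP[p_ge p_le]; rewrite /steady /expanding /shrinking.
  (* The energy conditions are scaled by [k] to stay linear in k p and k sigma. They place a +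
     lambda = k (sigma + 3 p) / 2 between - k sigma and 2 k sigma, whence all the bounds. *)
  have kp_ge : 0 <= k * (p q + sigma q) by rewrite mulr_ge0 ?(ltW k_gt0)//; lra.
  have kp_le : 0 <= k * (sigma q - p q) by rewrite mulr_ge0 ?(ltW k_gt0)// subr_ge0.
  have k2 : 0 < 2 * k by rewrite mulr_gt0.
  have := aE q; split => a_sgn.
  + by rewrite ge_max -mulNr ler_pdivrMr// ler_pdivrMr//; apply/andP; split; lra.
  + by rewrite ltr_pdivrMr//; lra.
  + by rewrite -mulNr ltr_pdivrMr//; lra.
Qed.
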